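(* Let $M=x_0^{a_0}\cdots x_n^{a_n}\in\mathbb{C}[x_0,\ldots,x_n]$ be a monomial with $a_i>1$ for all $i\in\{0,\ldots,n\}$. Let $\mathcal{M}=\{\partial_{x_0}M,\ldots,\partial_{x_n}M\}$ be the collection of its first partial derivatives. Then $$\mathrm{rk}_{\mathbb{C}}\,M=\mathrm{rk}_{\mathbb{C}}\,\mathcal{M}.$$
   Context: Here $n$ is a nonnegative integer, and a form is a homogeneous polynomial. For a finite collection of forms $\mathcal{F}=\{F_1,\ldots,F_s\}$ in $S=\mathbb{C}[x_0,\ldots,x_n]$ (degrees not necessarily equal), the simultaneous Waring rank $\mathrm{rk}_{\mathbb{C}}\,\mathcal{F}$ is the minimal integer $r$ such that there exist linear forms $L_1,\ldots,L_r\in S$ with the property that every $F_i$ can be written as $F_i=\sum_{j=1}^r\lambda_{i,j}L_j^{d_i}$ with $d_i=\deg F_i$ and $\lambda_{i,j}\in\mathbb{C}$. For a single form, $\mathrm{rk}_{\mathbb{C}}\,F=\mathrm{rk}_{\mathbb{C}}\{F\}$ is the usual complex Waring rank. *)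

(* Defs.v *)
From HB Require Import structures.
From mathcomp Require Import all_boot all_order all_algebra.
From mathcomp Require Import boolp reals complex mpoly.

Set Implicit Arguments.
Unset Strict Implicit.
Unset Printing Implicit Defensive.

Import Order.TTheory GRing.Theory Num.Theory.
Local Open Scope ring_scope.

(* For a form [F i], [(msize (F i)).-1] is its degree; the zero form, whose   *)
(* degree is a matter of convention, is decomposable for every convention.    *)
Definition waring_decomposable (K : fieldType) (n s : nat)
    (F : 'I_s -> {mpoly K[n]}) (r : nat) : Prop :=
  exists (L : 'I_r -> {mpoly K[n]}) (lambda : 'M[K]_(s, r)),
    (forall j, L j \is 1.-homog) /\
    (forall i, F i = \sum_(j < r) lambda i j *: L j ^+ (msize (F i)).-1).

(* The value 0 in the second branch is never used for forms in characteristic *)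
(* zero: see [simul_waring_rankP].                                            *)
Definition simul_waring_rank (K : fieldType) (n s : nat)
    (F : 'I_s -> {mpoly K[n]}) : nat :=
  if pselect (exists r, `[< waring_decomposable F r >]) is left exF
  then ex_minn exF else 0%N.

Definition waring_rank (K : fieldType) (n : nat) (F : {mpoly K[n]}) : nat :=
  simul_waring_rank (fun _ : 'I_1 => F).

Lemma polarization (A : comNzRingType) (d : nat) (y : 'I_d -> A) :
  d`!%:R * \prod_k y k =
  \sum_(S : {set 'I_d})
    (\prod_k (if k \in S then 1 else -1)) * (\sum_(k in S) y k) ^+ d.
Proof.
pose P (f : {ffun 'I_d -> 'I_d}) := \prod_k y (f k).
have powE (S : {set 'I_d}) :
    (\sum_(k in S) y k) ^+ d = \sum_(f | f \in ffun_on (mem S)) P f.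
  have -> : (\sum_(k in S) y k) ^+ d = \prod_(i < d) \sum_(k in S) y k.
    by rewrite prodr_const card_ord.
  exact: bigA_distr_big.
under [RHS]eq_bigr => S _ do rewrite powE mulr_sumr.
rewrite (exchange_big_dep predT) //=.
have coefE (f : {ffun 'I_d -> 'I_d}) :
    \sum_(S : {set 'I_d} | f \in ffun_on (mem S))
      (\prod_k (if k \in S then 1 else -1)) * P f
    = (if injectiveb f then P f else 0).
  have -> : (if injectiveb f then P f else 0)
      = (\prod_k (1 + (if k \in codom f then 0 else -1))) * P f.
    case: ifPn => [/injectiveP injf | ninjf].
      rewrite big1 ?mul1r // => k _.
      rewrite ifT ?addr0 //; apply/codomP.
      by have [g _ gK] := injF_bij injf; exists (g k); rewrite gK.
    have [/forallP|] := boolP [forall k, k \in codom f].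
      move=> fsurj; case/injectiveP: ninjf.
      have : #|codom f| == #|'I_d| by apply/eqP/eq_card => k; rewrite fsurj inE.
      by move/image_injP => injf x y' /injf; apply; rewrite inE.
    rewrite negb_forall => /existsP[k kNf].
    by rewrite (bigD1 k) //= (negPf kNf) subrr !mul0r.
  rewrite bigA_distr -mulr_suml; congr (_ * _).
  rewrite big_mkcond /=; apply: eq_bigr => S _.
  case: ifPn => [/ffun_onP fS | /ffun_onP fNS].
    apply: eq_bigr => k _; case: ifPn => // kNS.
    rewrite ifN //; apply: contra kNS => /codomP[x ->]; exact: fS.
  have [/forallP ?|] := boolP [forall k, f k \in S]; first by [].
  rewrite negb_forall => /existsP[k kNS].
  by rewrite (bigD1 (f k)) //= (negPf kNS) codom_f mul0r.
under [RHS]eq_bigr => f _ do rewrite coefE.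
rewrite -big_mkcond /=.
have PE (f : {ffun _ -> _}) : injectiveb f -> P f = \prod_k y k.
  by move/injectiveP=> injf; rewrite [RHS](reindex_inj injf).
rewrite [RHS](eq_bigr (fun=> \prod_k y k)); last exact: PE.
pose inj := [set f : {ffun 'I_d -> 'I_d} | injectiveb f].
rewrite [RHS](eq_bigl (fun f => f \in inj)); last first.
  by move=> f; rewrite !inE.
by rewrite sumr_const card_inj_ffuns !card_ord ffactnn mulr_natl.
Qed.

Lemma mpolyX_prod (K : fieldType) (n : nat) (m : 'X_{1..n}) :
  exists y : 'I_(mdeg m) -> {mpoly K[n]},
    (forall k, y k \is 1.-homog) /\ 'X_[m] = \prod_k y k.
Proof.
pose t := flatten [seq nseq (m i) i | i <- index_enum 'I_n].
have szt : size t = mdeg m.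
  rewrite size_flatten /shape -map_comp sumnE big_map mdegE.
  by apply: eq_bigr => i _; rewrite /= size_nseq.
have Xt : 'X_[m] = \prod_(i <- t) ('X_i : {mpoly K[n]}).
  rewrite mpolyXE_id big_flatten big_map /=.
  apply: eq_bigr => i _; rewrite big_nseq; elim: (m i) => [|k IH] /=.
    by rewrite expr0.
  by rewrite exprS IH.
rewrite -szt; exists (fun k => 'X_(tnth (in_tuple t) k)); split.
  by move=> k; rewrite dhomogX /= mdeg1.
by rewrite Xt [LHS]big_tnth.
Qed.

Definition power_sum (K : fieldType) (n d : nat) (p : {mpoly K[n]}) : Prop :=
  exists l : seq (K * {mpoly K[n]}),
    (forall z, z \in l -> z.2 \is 1.-homog) /\
    p = \sum_(z <- l) z.1 *: z.2 ^+ d.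

Lemma power_sumZ (K : fieldType) (n d : nat) (c : K) (p : {mpoly K[n]}) :
  power_sum d p -> power_sum d (c *: p).
Proof.
case=> l [hl ->]; exists [seq (c * z.1, z.2) | z <- l]; split.
  by move=> x /mapP[z zl ->] /=; exact: hl zl.
by rewrite big_map scaler_sumr; apply: eq_bigr => z _; rewrite /= scalerA.
Qed.

Lemma power_sum_sum (K : fieldType) (n d : nat) (I : eqType) (t : seq I)
    (p : I -> {mpoly K[n]}) :
  {in t, forall i, power_sum d (p i)} -> power_sum d (\sum_(i <- t) p i).
Proof.
elim: t => [_|i t IH ht]; first by exists [::]; rewrite !big_nil.
have [|l [hl El]] := IH; first by move=> j jt; apply: ht; rewrite inE jt orbT.
have [|k [hk Ek]] := ht i; first by rewrite inE eqxx.
exists (k ++ l); split; last by rewrite big_cons big_cat /= Ek El.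
by move=> z; rewrite mem_cat => /orP[/hk | /hl].
Qed.

Lemma power_sumX (K : numFieldType) (n : nat) (m : 'X_{1..n}) :
  power_sum (mdeg m) ('X_[m] : {mpoly K[n]}).
Proof.
have [y [hy ->]] := mpolyX_prod K m; set d := mdeg m in y hy *.
have dN0 : (d`!%:R : K) != 0 by rewrite pnatr_eq0 -lt0n fact_gt0.
have -> : \prod_k y k = d`!%:R^-1 *: (d`!%:R * \prod_k y k).
  by rewrite mulr_natl -scaler_nat scalerA mulVf // scale1r.
apply: power_sumZ; rewrite polarization.
apply: power_sum_sum => S _.
exists [:: (\prod_k (if k \in S then 1 else -1), \sum_(k in S) y k)]; split.
  by move=> z; rewrite inE => /eqP -> /=; rewrite rpred_sum // => k _; exact: hy.
rewrite big_seq1 /= -mul_mpolyC; congr (_ * _).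
rewrite rmorph_prod /=; apply: eq_bigr => k _.
by case: ifP => _; rewrite ?mpolyCN mpolyC1.
Qed.

Lemma power_sum_form (K : numFieldType) (n d : nat) (p : {mpoly K[n]}) :
  p \is d.-homog -> power_sum d p.
Proof.
move=> hp; rewrite [p]mpolyE; apply: power_sum_sum => m mp.
apply: power_sumZ; have <- : mdeg m = d by move/dhomogP: hp; apply.
exact: power_sumX.
Qed.

Lemma waring_decomposable_forms (K : numFieldType) (n s : nat)
    (F : 'I_s -> {mpoly K[n]}) :
  (forall i, exists d, F i \is d.-homog) -> exists r, waring_decomposable F r.
Proof.
move=> hF.
have hp i : power_sum (msize (F i)).-1 (F i).
  by have [d hd] := hF i; apply: power_sum_form; apply: dhomog_msize hd.
have [l hl] := choice hp.
pose J := {i : 'I_s & 'I_(size (l i))}.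
pose z (u : J) := tnth (in_tuple (l (tag u))) (tagged u).
exists #|{: J}|, (fun j => (z (enum_val j)).2),
  (\matrix_(i, j) if tag (enum_val j) == i then (z (enum_val j)).1 else 0).
split=> [j | i]; first by apply: (hl _).1; apply: mem_tnth.
have [_ {1}->] := hl i; set d := (msize _).-1.
transitivity (\sum_(u : J | tag u == i) (z u).1 *: (z u).2 ^+ d).
  rewrite big_tnth.
  pose G i (k : 'I_(size (l i))) :=
    (tnth (in_tuple (l i)) k).1 *: (tnth (in_tuple (l i)) k).2 ^+ d.
  transitivity (\sum_(i' | i' == i) \sum_(k < size (l i')) G i' k).
    by rewrite big_pred1_eq.
  by rewrite sig_big_dep /=; apply: eq_big => u //=; rewrite andbT.
rewrite big_mkcond (reindex (@enum_val J predT)) /=; last first.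
  exact/onW_bij/enum_val_bij.
by apply: eq_bigr => j _; rewrite mxE; case: ifP; rewrite ?scale0r.
Qed.

Lemma simul_waring_rankP (K : numFieldType) (n s : nat)
    (F : 'I_s -> {mpoly K[n]}) :
  (forall i, exists d, F i \is d.-homog) ->
  waring_decomposable F (simul_waring_rank F) /\
  (forall r, waring_decomposable F r -> (simul_waring_rank F <= r)%N).
Proof.
move=> /waring_decomposable_forms [r0 hr0]; rewrite /simul_waring_rank.
case: pselect => [exF | []]; last by exists r0; apply/asboolP.
case: ex_minnP => r /asboolP hr rmin; split=> // r' hr'.
by apply: rmin; apply/asboolP.
Qed.

(* Main.v *)
(* Let x_0 be a variable of least exponent and N the product of the a_i + 1
   over i <> 0. Then N <= rk(partials) <= rk M <= N, as follows.

   rk M <= N: summing (prod_i z_i^k_i) (x_0 + sum_i z_i^k_i x_i)^|a| over all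
   0 <= k_i <= a_i (i <> 0), with z_i a primitive (a_i + 1)-th root of unity,
   keeps only the monomials x^b such that a_i + 1 divides b_i + 1 for all i
   <> 0, and minimality of a_0 leaves b = a alone.

   rk(partials) <= rk M: differentiate a power sum decomposition of M.

   N <= rk(d_0 M): if x^a with a_0 > 0 is a combination of |a|-th powers of
   linear forms with coefficient vectors p_j, then a form of degree |a|
   vanishing at all the p_j does not involve x^a (apolarity). A linear
   relation between the N functions (x/x_0)^f, f <= a, f_0 = 0, on the p_j
   with x_0 <> 0 would give such a form involving x^a: homogenize it,
   multiply by x_0^a_0, which kills the other p_j, and by x^(a - g - a_0 e_0)
   for a g of largest degree in the relation. This applies to d_0 M because
   a_0 > 1. *)

Require Import Defs.
From HB Require Import structures.
From mathcomp Require Import all_boot all_order all_algebra.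
From mathcomp Require Import boolp reals complex mpoly.
From mathcomp Require Import cyclic separable cyclotomic.

Set Implicit Arguments.
Unset Strict Implicit.
Unset Printing Implicit Defensive.

Import Order.TTheory GRing.Theory Num.Theory.
Local Open Scope ring_scope.

(** * Roots of unity and their power sums *)

Lemma prim_root_exists (K : numClosedFieldType) (m : nat) :
  (0 < m)%N -> exists z : K, m.-primitive_root z.
Proof.
move=> m_gt0; pose p : {poly K} := 'X^m - 1.
have [r Dp] := closed_field_poly_normal p.
rewrite (monicP _) ?monicXnsubC // scale1r in Dp.
have rm1 : all m.-unity_root r by apply/allP=> z; rewrite -root_prod_XsubC -Dp.
have sz_r : (m < (size r).+1)%N.
  by rewrite -(size_prod_XsubC r id) -Dp size_XnsubC.
have [|z _] := hasP (has_prim_root m_gt0 rm1 _ sz_r); last by exists z.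
by rewrite -separable_prod_XsubC -Dp separable_Xn_sub_1 // pnatr_eq0 -lt0n.
Qed.

Lemma sum_expr_unity (A : idomainType) (m : nat) (z : A) :
  z ^+ m = 1 -> \sum_(k < m) z ^+ k = if z == 1 then m%:R else 0.
Proof.
move=> zm; case: eqP => [-> | /eqP z1].
  by under eq_bigr => k _ do rewrite expr1n; rewrite sumr_const card_ord.
apply/eqP; have /eqP := subrX1 z m; rewrite zm subrr eq_sym mulf_eq0.
by rewrite subr_eq0 (negPf z1).
Qed.

(** * Derivatives and coefficients of powers of linear forms *)

Lemma mderiv_exp (A : comNzRingType) (n d : nat) (i : 'I_n) (p : {mpoly A[n]}) :
  (p ^+ d)^`M(i) = d%:R *: (p^`M(i) * p ^+ d.-1).
Proof.
elim: d => [|d IH]; first by rewrite expr0 -mpolyC1 mderivC scale0r.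
rewrite exprS mderivM IH /= -[in RHS]natr1 addrC scalerDl scale1r.
congr (_ + _).
case: d {IH} => [|d]; first by rewrite !scale0r mulr0.
by rewrite -scalerAr mulrCA -exprS.
Qed.

Lemma dhomog1E (A : nzRingType) (n : nat) (L : {mpoly A[n]}) :
  L \is 1.-homog -> L = \sum_i L@_U_(i) *: 'X_i.
Proof.
move=> hL; apply/mpolyP => m; rewrite raddf_sum /=.
under eq_bigr => i _ do rewrite mcoeffZ mcoeffX.
have [/eqP/mdeg1P[i /eqP ->] | m1] := eqVneq (mdeg m) 1%N.
  rewrite (bigD1 i) //= eqxx mulr1 big1 ?addr0 // => j ji.
  by rewrite eq_mnm1 (negPf ji) mulr0.
rewrite (dhomog_nemf_coeff hL m1) big1 // => i _.
rewrite (_ : (_ == m) = false) ?mulr0 //; apply: contraNF m1 => /eqP <-.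
by rewrite mdeg1.
Qed.

(* The multinomial coefficient [(mdeg b)! / \prod_i (b i)!], as the number of *)
(* words whose letter [i] occurs [b i] times.                                 *)
Definition multinomial (n : nat) (b : 'X_{1..n}) : nat :=
  #|[set g : {ffun 'I_(mdeg b) -> 'I_n} | (\sum_k U_(g k))%MM == b]|.

Lemma multinomial_gt0 (n : nat) (b : 'X_{1..n}) : (0 < multinomial b)%N.
Proof.
have sz := size_m2s b.
pose t : (mdeg b).-tuple 'I_n := Tuple (introT eqP sz).
apply/card_gt0P; exists [ffun k => tnth t k]; rewrite inE.
apply/eqP; rewrite -[RHS]s2mK; apply/mnmP => i.
rewrite mnm_sumE mnmE -sum1_count.
rewrite (big_tuple _ _ t) [RHS]big_mkcond /=; apply: eq_bigr => k _.
by rewrite ffunE mnm1E; case: eqP.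
Qed.

Lemma mcoeff_linear_exp (A : comNzRingType) (n : nat) (p : 'I_n -> A)
    (b : 'X_{1..n}) :
  ((\sum_i p i *: 'X_i) ^+ mdeg b)@_b
  = (multinomial b)%:R * \prod_i p i ^+ b i.
Proof.
have -> : (\sum_i p i *: 'X_i : {mpoly A[n]}) ^+ mdeg b
    = \prod_(k < mdeg b) \sum_i p i *: 'X_i by rewrite prodr_const card_ord.
rewrite bigA_distr_bigA /= raddf_sum /=.
transitivity (\sum_(g : {ffun 'I_(mdeg b) -> 'I_n} | (\sum_k U_(g k))%MM == b)
    \prod_i p i ^+ b i).
  rewrite [RHS]big_mkcond; apply: eq_bigr => g _.
  under eq_bigr => k _ do rewrite -mul_mpolyC.
  rewrite big_split /= -rmorph_prod /= mprodXE mul_mpolyC mcoeffZ mcoeffX.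
  case: eqP => [E|_]; last by rewrite mulr0.
  rewrite mulr1 -[in RHS]E.
  under [RHS]eq_bigr => i _ do rewrite mnm_sumE -prodrXr.
  rewrite exchange_big /=; apply: eq_bigr => k _.
  rewrite (bigD1 (g k)) //= mnm1E eqxx expr1 big1 ?mulr1 // => i ik.
  by rewrite mnm1E eq_sym (negPf ik) expr0.
rewrite sumr_const mulr_natl; congr (_ *+ _).
by apply: eq_card => g; rewrite !inE.
Qed.

Lemma mcoeff_dhomog1_exp (A : comNzRingType) (n : nat) (L : {mpoly A[n]})
    (b : 'X_{1..n}) :
  L \is 1.-homog ->
  (L ^+ mdeg b)@_b = (multinomial b)%:R * \prod_i L@_U_(i) ^+ b i.
Proof. by move=> hL; rewrite {1}(dhomog1E hL) mcoeff_linear_exp. Qed.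

(** Each [L j] has constant partial derivatives, so differentiating its [d]-th power yields a
    multiple of [L j ^+ d.-1]; the hypothesis makes this the exponent prescribed for every
    partial. *)
Lemma waring_decomposable_mderiv (K : numFieldType) (n r : nat)
    (M : {mpoly K[n]}) :
  (forall i, msize M^`M(i) = (msize M).-1) ->
  waring_decomposable (fun _ : 'I_1 => M) r ->
  waring_decomposable (fun i : 'I_n => M^`M(i)) r.
Proof.
move=> hM [L [lambda [hL E]]]; set d := (msize M).-1 in E.
exists L, (\matrix_(i, j) (lambda 0 j * d%:R * (L j)@_U_(i))); split=> // i.
rewrite {1}(E 0) raddf_sum /=; apply: eq_bigr => j _.
rewrite mderivZ mderiv_exp hM -/d mxE -2!scalerA; congr (_ *: (_ *: _)).
rewrite {1}[L j](dhomog1E (hL j)) raddf_sum /= (bigD1 i) //= big1 => [|k ki].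
  rewrite addr0 mderivZ mderivX mnm1E eqxx scale1r.
  have -> : (U_(i) - U_(i) = 0 :> 'X_{1..n})%MM.
    by apply/mnmP => k; rewrite mnmBE subnn mnm0E.
  by rewrite mpolyX0 -scalerAl mul1r.
by rewrite mderivZ mderivX mnm1E (negPf ki) scale0r scaler0.
Qed.

(** * Lower bound by apolarity *)

(** The factor [c] lets the bound apply to a partial derivative of a monomial; [D] keeps the
    exponents [f] in a finite type. *)
Lemma monomial_power_sum_length_ge (K : numFieldType) (n D r : nat)
    (a : 'X_{1..n}) (i0 : 'I_n) (B : {set {ffun 'I_n -> 'I_D}}) (c : K)
    (lambda : 'I_r -> K) (L : 'I_r -> {mpoly K[n]}) :
  (0 < a i0)%N ->
  {in B, forall f : {ffun 'I_n -> 'I_D},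
    f i0 = 0 :> nat /\ forall i, (f i <= a i)%N} ->
  c != 0 -> (forall j, L j \is 1.-homog) ->
  c *: 'X_[a] = \sum_(j < r) lambda j *: L j ^+ mdeg a ->
  (#|B| <= r)%N.
Proof.
move=> ai0 hB c0 hL E; rewrite leqNgt; apply/negP => ltrB.
pose p j i := (L j)@_U_(i).
pose e (k : 'I_#|B|) : {ffun 'I_n -> 'I_D} := enum_val k.
have eB k : e k \in B by exact: enum_valP.
pose w k := (\sum_i e k i)%N.
(* Division by [p j i0 = 0] returns 0; [vanish] treats such points separately. *)
pose V := \matrix_(k < #|B|, j < r) \prod_i (p j i / p j i0) ^+ e k i.
have : kermx V != 0.
  rewrite kermx_eq0 /row_free neq_ltn (leq_ltn_trans _ ltrB) //.
  exact: rank_leq_col.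
case/rowV0Pn => v /sub_kermxP vV /rV0Pn [k1 vk1].
(* Maximality of [w k0] on the support of [v] keeps the exponent [a i0 + w k0 - w k] at least
   [a i0], hence positive and untruncated. *)
have [k0 vk0 kmax] := @arg_maxnP _ k1 (fun k => v 0 k != 0) w vk1.
(* Exponents of the homogenized relation, shifted so that [G k0 = a].         *)
pose G k := [multinom (if i == i0 then a i + w k0 - w k
                       else a i - e k0 i + e k i)%N | i < n].
have degG k : v 0 k != 0 -> mdeg (G k) = mdeg a.
  move=> /kmax lek; have lek' : (w k <= a i0 + w k0)%N.
    exact: leq_trans lek (leq_addl _ _).
  have wE k' : w k' = (\sum_(i | i != i0) e k' i)%N.
    by rewrite /w (bigD1 i0) //= (hB _ (eB k')).1.
  apply/eqP; rewrite !mdegE (bigD1 i0) //= [X in _ == X](bigD1 i0) //=.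
  rewrite mnmE eqxx.
  rewrite -(eqn_add2r (w k0)) -addnA -addnA.
  have -> : (\sum_(i | i != i0) G k i + w k0
      = \sum_(i | i != i0) a i + w k)%N.
    rewrite !wE -!big_split /=; apply: eq_bigr => i ii0.
    by rewrite mnmE (negPf ii0) addnAC subnK //; apply: (hB _ (eB k0)).2.
  by rewrite addnCA subnK // addnCA.
have Ga k : (a == G k) = (k == k0).
  apply/eqP/eqP => [/mnmP aG | ->]; last first.
    apply/mnmP => i; rewrite mnmE addnK subnK ?if_same //.
    exact: (hB _ (eB k0)).2.
  apply: enum_val_inj; apply/ffunP => i; apply: val_inj; rewrite /= -!/(e _).
  have [->|ii0] := eqVneq i i0; first by rewrite !(hB _ (eB _)).1.
  have := aG i; rewrite mnmE (negPf ii0).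
  rewrite -{1}(subnK ((hB _ (eB k0)).2 i)) => /eqP.
  by rewrite eqn_add2l => /eqP.
have vanish j : \sum_k v 0 k * \prod_i p j i ^+ G k i = 0.
  have [p0|p0] := eqVneq (p j i0) 0.
    rewrite big1 // => k _.
    have [->|vk] := eqVneq (v 0 k) 0; first by rewrite mul0r.
    have wlt : (w k < a i0 + w k0)%N by rewrite -add1n leq_add //; exact: kmax.
    rewrite (bigD1 i0) //= mnmE eqxx p0 expr0n eqn0Ngt subn_gt0 wlt.
    by rewrite mul0r mulr0.
  (* The prefactor clears denominators and shifts by [a - e k0], turning the relation [v *m V = 0]
     into the form with exponents [G k]. *)
  transitivity ((p j i0 ^+ (a i0 + w k0) *
      \prod_(i | i != i0) p j i ^+ (a i - e k0 i)) * (v *m V) 0 j); last first.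
    by rewrite vV mxE mulr0.
  rewrite mxE mulr_sumr; apply: eq_bigr => k _; rewrite mxE.
  have [->|vk] := eqVneq (v 0 k) 0; first by rewrite !mul0r mulr0.
  have wle : (w k <= a i0 + w k0)%N.
    by apply: leq_trans (leq_addl _ _); apply: kmax.
  rewrite mulrCA; congr (_ * _).
  have -> : \prod_i (p j i / p j i0) ^+ e k i
      = \prod_(i | i != i0) p j i ^+ e k i / p j i0 ^+ w k.
    under eq_bigr => i _ do rewrite expr_div_n.
    by rewrite big_split /= prodfV prodrXr (bigD1 i0) //= (hB _ (eB k)).1 mul1r.
  rewrite mulrA -[X in X / _]mulrA -big_split /= mulrAC.
  rewrite -exprB ?unitfE //.
  rewrite (bigD1 i0) //= mnmE eqxx; congr (_ * _); apply: eq_bigr => i ii0.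
  by rewrite mnmE (negPf ii0) exprD.
have coefG k : v 0 k != 0 ->
    \sum_j lambda j * \prod_i p j i ^+ G k i
    = c / (multinomial a)%:R * (k == k0)%:R.
  move=> vk; have : (c *: 'X_[a])@_(G k)
      = (\sum_(j < r) lambda j *: L j ^+ mdeg a)@_(G k) by rewrite E.
  rewrite mcoeffZ mcoeffX Ga raddf_sum /= -(degG _ vk).
  under eq_bigr => j _ do rewrite mcoeffZ mcoeff_dhomog1_exp // mulrCA.
  rewrite -mulr_sumr => EG.
  have NG : (multinomial (G k))%:R != 0 :> K.
    by rewrite pnatr_eq0 -lt0n multinomial_gt0.
  apply: (mulfI NG); rewrite -EG; have [-> | _] := eqVneq k k0; last first.
    by rewrite !mulr0.
  have -> : G k0 = a by apply/esym/eqP; rewrite Ga.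
  rewrite !mulr1 mulrC divfK //.
  by rewrite pnatr_eq0 -lt0n multinomial_gt0.
(* This pairs the form with the decomposition: evaluation at the points gives 0, while by [coefG]
   only the nonzero [k0] term survives. *)
have : \sum_k v 0 k * \sum_j lambda j * \prod_i p j i ^+ G k i = 0.
  under eq_bigr => k _ do rewrite mulr_sumr.
  rewrite exchange_big /=; apply: big1 => j _.
  under eq_bigr => k _ do rewrite mulrCA.
  by rewrite -mulr_sumr vanish mulr0.
rewrite (bigD1 k0) //= [X in _ + X]big1 => [|k kk0]; last first.
  have [->|vk] := eqVneq (v 0 k) 0; first by rewrite mul0r.
  by rewrite coefG // (negPf kk0) !mulr0.
rewrite coefG // eqxx mulr1 addr0 => /eqP; apply/negP.
by rewrite !mulf_neq0 // invr_neq0 // pnatr_eq0 -lt0n multinomial_gt0.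
Qed.

(** * Upper bound by averaging over roots of unity *)

(** If [b i <> a i] for some [i <> i0], then [(b i).+1] is at least twice [(a i).+1]; this excess of
    more than [a i0] cannot be offset at [i0], the only place where [b] may be smaller. *)
Lemma mnm_eq_of_dvdn (n : nat) (a b : 'X_{1..n}) (i0 : 'I_n) :
  (forall i, (a i0 <= a i)%N) -> mdeg b = mdeg a ->
  (forall i, i != i0 -> ((a i).+1 %| (b i).+1)%N) -> b = a.
Proof.
move=> amin degE dvd.
have le i : i != i0 -> (a i <= b i)%N by move=> /dvd /dvdn_leq; apply.
have eqi i : i != i0 -> b i = a i.
  move=> ii0; have /dvdnP [[|[|q]] // bE] := dvd _ ii0.
    by move: bE; rewrite mul1n => -[].
  have : (mdeg a < mdeg b)%N; last by rewrite degE ltnn.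
  rewrite !mdegE (bigD1 i) //= (bigD1 i0) 1?eq_sym //= addnA.
  rewrite [X in (_ < X)%N](bigD1 i) //=.
  rewrite [X in (_ < _ + X)%N](bigD1 i0) 1?eq_sym //=.
  rewrite addnA -addSn leq_add //; last first.
    by apply: leq_sum => k /andP [_ kk]; exact: le.
  apply: leq_trans (leq_addr _ _).
  rewrite -ltnS bE !mulSn addnA (leq_trans _ (leq_addr _ _)) //.
  by rewrite addnS addSn !ltnS leq_add2l.
apply/mnmP => i; have [-> | /eqi //] := eqVneq i i0.
move: degE; rewrite !mdegE (bigD1 i0) //= [in RHS](bigD1 i0) //=.
by rewrite (eq_bigr a eqi) => /eqP; rewrite eqn_add2r => /eqP.
Qed.

Lemma waring_decomposable_monomial (K : numClosedFieldType) (n D : nat)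
    (a : 'X_{1..n}) (i0 : 'I_n) (m : 'I_n -> nat) :
  (forall i, (a i0 <= a i)%N) ->
  (forall i, m i = if i == i0 then 1%N else (a i).+1) ->
  (forall i, (m i <= D)%N) ->
  waring_decomposable (fun _ : 'I_1 => 'X_[a] : {mpoly K[n]})
    #|[set f in family (fun i => [pred k : 'I_D | (k < m i)%N])]|.
Proof.
move=> amin mE mD; set B := [set f in _].
have m_gt0 i : (0 < m i)%N by rewrite mE; case: ifP.
have [z hz] := choice (fun i => prim_root_exists K (m_gt0 i)).
pose L (f : {ffun 'I_n -> 'I_D}) : {mpoly K[n]} := \sum_i z i ^+ f i *: 'X_i.
(* As [- a i] is 1 modulo [(a i).+1], this weight cancels the factor [\prod_i z i ^+ (f i * a i)] of
   ['X_[a]] in the power of [L f]. *)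
pose u (f : {ffun 'I_n -> 'I_D}) := \prod_i z i ^+ f i.
have hL f : L f \is 1.-homog.
  by rewrite rpred_sum // => i _; rewrite rpredZ // dhomogX /= mdeg1.
pose N : K := (multinomial a)%:R * (\prod_i m i)%:R.
have N0 : N != 0.
  by rewrite mulf_neq0 // pnatr_eq0 -lt0n ?multinomial_gt0 // prodn_gt0.
have E : \sum_(f in B) u f *: L f ^+ mdeg a = N *: 'X_[a].
  apply/mpolyP => b; rewrite mcoeffZ mcoeffX raddf_sum /=.
  have [degE | degN] := eqVneq (mdeg b) (mdeg a); last first.
    rewrite big1 => [|f _].
      by have [ab|] := eqVneq a b; [rewrite ab eqxx in degN | rewrite mulr0].
    have hLa : L f ^+ mdeg a \is (mdeg a).-homog.
      by rewrite -{2}[mdeg a]mul1n dhomogMn.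
    by rewrite mcoeffZ (dhomog_nemf_coeff hLa) ?mulr0.
  (* The sum over [B] factors into one geometric sum per variable, which vanishes unless [m i]
     divides [(b i).+1]. *)
  have -> : \sum_(f in B) (u f *: L f ^+ mdeg a)@_b
      = (multinomial b)%:R *
        \prod_i \sum_(k < D | (k < m i)%N) (z i ^+ (b i).+1) ^+ k.
    rewrite bigA_distr_big_dep mulr_sumr.
    apply: eq_big => [f | f _]; first by rewrite inE.
    rewrite mcoeffZ -degE mcoeff_linear_exp mulrCA; congr (_ * _).
    rewrite -big_split /=; apply: eq_bigr => i _.
    by rewrite -!exprM -exprD mulSn mulnC.
  under eq_bigr => i _.
    rewrite -(big_ord_widen D (fun k => (z i ^+ (b i).+1) ^+ k)) //.
    rewrite sum_expr_unity; last first.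
      by rewrite -exprM mulnC exprM (prim_expr_order (hz i)) expr1n.
    rewrite -(prim_order_dvd (hz i)).
    over.
  have [<- | ab] := eqVneq a b.
    rewrite mulr1 /N natr_prod; congr (_ * _); apply: eq_bigr => i _.
    by rewrite ifT // mE; case: ifP => _; rewrite ?dvd1n ?dvdnn.
  have [i ndvd] : exists i, ~~ (m i %| (b i).+1)%N.
    apply/existsP; apply: contraR ab; rewrite negb_exists => /forallP dvd.
    rewrite eq_sym; apply/eqP/(mnm_eq_of_dvdn amin degE) => i ii0.
    by have := dvd i; rewrite negbK mE (negPf ii0).
  by rewrite (bigD1 i) //= (negPf ndvd) mul0r !mulr0.
exists (fun j => L (enum_val j)), (\matrix_(_, j) (N^-1 * u (enum_val j))).
split=> [//|i]; rewrite msizeX /=.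
rewrite -[LHS](scalerK N0) -E scaler_sumr big_enum_val /=.
by apply: eq_bigr => j _; rewrite mxE scalerA.
Qed.

Theorem proposition3p8 (R : realType) (n : nat) (a : 'X_{1..n.+1})
    (M : {mpoly R[i][n.+1]}) (hM : M = 'X_[a])
    (ha : forall i : 'I_n.+1, (1 < a i)%N) :
  waring_rank M = simul_waring_rank (fun i : 'I_n.+1 => M^`M(i)).
Proof.
have dM i : M^`M(i) = (a i)%:R *: 'X_[a - U_(i)] by rewrite hM mderivX.
have ai0 i : (a i)%:R != 0 :> R[i] by rewrite pnatr_eq0 -lt0n ltnW.
have dega i : mdeg (a - U_(i)) = (mdeg a).-1.
  have le1a : (U_(i) <= a)%MM by rewrite lep1mP -lt0n ltnW.
  by rewrite -{2}(submK le1a) mdegD mdeg1 addn1.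
have szdM i : msize M^`M(i) = (mdeg (a - U_(i))).+1.
  by rewrite dM msizeZ ?msizeX.
have szM i : msize M^`M(i) = (msize M).-1.
  rewrite szdM hM msizeX dega /= prednK //.
  by rewrite mdegE (bigD1 i) //= ltn_addr // ltnW.
have [Mrk Mmin] : waring_decomposable (fun _ : 'I_1 => M) (waring_rank M) /\
    forall r, waring_decomposable (fun _ : 'I_1 => M) r ->
      (waring_rank M <= r)%N.
  by apply: simul_waring_rankP => _; exists (mdeg a); rewrite hM dhomogX.
have [dMrk dMmin] : waring_decomposable (fun i => M^`M(i))
      (simul_waring_rank (fun i => M^`M(i))) /\
    forall r, waring_decomposable (fun i => M^`M(i)) r ->
      (simul_waring_rank (fun i => M^`M(i)) <= r)%N.
  apply: simul_waring_rankP => i; exists (mdeg (a - U_(i))).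
  by rewrite dM rpredZ // dhomogX.
apply/eqP; rewrite eqn_leq [X in _ && X]dMmin ?andbT; last first.
  exact: waring_decomposable_mderiv Mrk.
have [i0 _ amin] := @arg_minnP _ ord0 predT a isT.
pose m i := if i == i0 then 1%N else (a i).+1.
pose D := (\max_i m i)%N.
pose B := [set f in family (fun i => [pred k : 'I_D | (k < m i)%N])].
(* The set [B] indexes both the powers in a decomposition of [M] and the independent functions of
   the lower bound. *)
apply: (@leq_trans #|B|).
  apply: Mmin; rewrite hM.
  apply: (@waring_decomposable_monomial _ _ _ _ i0) => // i; first exact: amin.
  exact: leq_bigmax.
case: dMrk => L [lambda [hL E]].
(* The bound is applied to the partial at [i0]: lowering that exponent respects [B], where
   [f i0 = 0], and [1 < a i0] keeps it positive. *)
apply: (@monomial_power_sum_length_ge _ _ D _ (a - U_(i0)) i0 B (a i0)%:R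
  (lambda i0) L) => //.
- by rewrite mnmBE mnm1E eqxx subn_gt0.
- move=> f; rewrite inE => /familyP fB.
  have fB' i : (f i < m i)%N by apply: fB.
  split=> [|i]; first by have := fB' i0; rewrite /m eqxx ltnS leqn0 => /eqP.
  have := fB' i; rewrite /m mnmBE mnm1E eq_sym.
  case: (i0 == i); first by rewrite ltnS leqn0 => /eqP ->.
  by rewrite ltnS subn0.
by rewrite -dM E szdM.
Qed.
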